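(* Let $F_s(\mathbf{X})=f_s(\boldsymbol{\lambda}(\mathbf{X}))$ and $G_s(\mathbf{X})=g_s(\boldsymbol{\lambda}(\mathbf{X}))$. Then $\mathrm{conv}(\mathrm{epi}(F_s))=\mathrm{epi}(G_s)$, where the epigraphs are given by $$\mathrm{epi}(F_s)=\{(t,\mathbf{X})\in\mathbb{R}\times\mathbb{S}^d:\ \exists\boldsymbol{\xi}\in\mathbb{R}^d\text{ s.t. }t\ge f_s(\boldsymbol{\xi}),\ (\boldsymbol{\xi},\mathbf{X})\in\overline{\Omega}\},$$ $$\mathrm{epi}(G_s)=\{(t,\mathbf{X})\in\mathbb{R}\times\mathbb{S}^d:\ \exists\boldsymbol{\xi}\in\mathbb{R}^d\text{ s.t. }t\ge f_s(\boldsymbol{\xi}),\ (\boldsymbol{\xi},\mathbf{X})\in\widehat{\Omega}\}.$$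
   Context: $\mathbb{S}^d$ is the space of real symmetric $d\times d$ matrices, $\mathbb{S}^d_+$ its positive semidefinite cone; $\boldsymbol{\lambda}(\mathbf{X})$ is the vector of eigenvalues in nonincreasing order. $\varphi:\mathbb{R}_{++}\to\mathbb{R}$ is closed, convex, nonincreasing, extended by $+\infty$ outside $\mathbb{R}_{++}$ (closed: the extension is lower semicontinuous). $1\le s\le d$ is an integer and $f_s(\boldsymbol{\xi})=\sum_{i=1}^s\varphi(\xi_i)$. $\mathbb{K}_{o,d}=\{\mathbf{x}\in\mathbb{R}^d: x_1\ge\dots\ge x_d\}$. $\mathbf{u}\succcurlyeq_m\mathbf{w}$ (majorization) means $\sum_i u_i=\sum_i w_i$ and for each $j\le d-1$ the sum of the $j$ largest entries of $\mathbf{u}$ is at least that of $\mathbf{w}$. $$g_s(\boldsymbol{\lambda})=\min_{\boldsymbol{\xi}\in\mathbb{R}^d_+}\{f_s(\boldsymbol{\xi}):\ \boldsymbol{\xi}\succcurlyeq_m\boldsymbol{\lambda},\ \boldsymbol{\xi}\in\mathbb{K}_{o,d}\},$$ $$\overline{\Omega}=\{(\boldsymbol{\xi},\mathbf{X})\in\mathbb{R}^d_+\times\mathbb{S}^d_+:\ \boldsymbol{\xi}=\boldsymbol{\lambda}(\mathbf{X}),\ \boldsymbol{\xi}\in\mathbb{K}_{o,d}\},\qquad \widehat{\Omega}=\{(\boldsymbol{\xi},\mathbf{X})\in\mathbb{R}^d_+\times\mathbb{S}^d_+:\ \boldsymbol{\xi}\succcurlyeq_m\boldsymbol{\lambda}(\mathbf{X}),\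 \boldsymbol{\xi}\in\mathbb{K}_{o,d}\}.$$ The domain of both $F_s$ and $G_s$ is the set of positive semidefinite matrices of rank at least $s$ (both are $+\infty$ elsewhere). $\mathrm{epi}(F)=\{(t,\mathbf{X})\in\mathbb{R}\times\mathbb{S}^d: t\ge F(\mathbf{X})\}$; $\mathrm{conv}$ is the convex hull (no closure). *)

(* Defs.v *)
From HB Require Import structures.
From mathcomp Require Import all_boot all_order all_algebra.
From mathcomp Require Import all_classical all_reals all_analysis.
From mathcomp Require Import complex spectral.
Set Implicit Arguments.
Unset Strict Implicit.
Unset Printing Implicit Defensive.
Import Order.TTheory GRing.Theory Num.Theory.
Import numFieldNormedType.Exports.
Local Open Scope classical_set_scope.
Local Open Scope ring_scope.

Section Eigenvalues.
Variables (R : realType) (d : nat).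
Implicit Types (u v : 'rV[R]_d) (X : 'M[R]_d).

Definition nonincreasing_vec v := forall i j : 'I_d, (i <= j)%N -> v 0 j <= v 0 i.

Definition nonneg_vec v := forall i : 'I_d, 0 <= v 0 i.

Definition is_eigvals X v :=
  nonincreasing_vec v /\ char_poly X = \prod_(i < d) ('X - (v 0 i)%:P).

(* The default value is only reached by matrices whose characteristic
   polynomial does not split over R; by eigvalsP and eigvals_uniq below,
   a symmetric X has exactly one vector satisfying is_eigvals X. *)
Definition eigvals X : 'rV[R]_d := xget 0 [set v | is_eigvals X v].

Definition symmetric_mx X := X^T = X.

Definition psd_mx X :=
  symmetric_mx X /\ forall v : 'cV[R]_d, 0 <= (v^T *m X *m v) 0 0.

Definition sum_largest (j : nat) u : R :=
  \sum_(x <- take j (sort >=%R [seq u 0 i | i <- enum 'I_d])) x.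

Definition majorizes u v :=
  \sum_i u 0 i = \sum_i v 0 i /\
  forall j : nat, (j < d)%N -> sum_largest j v <= sum_largest j u.

Lemma nonincreasing_sorted v : nonincreasing_vec v ->
  sorted >=%R [seq v 0 i | i <- enum 'I_d].
Proof.
move=> vmon; rewrite sorted_map.
have : sorted (fun i j : 'I_d => (i < j)%N) (enum 'I_d).
  have := iota_ltn_sorted 0 d; rewrite -val_enum_ord sorted_map; exact.
by apply: sub_sorted => i j /= ij; apply: vmon; apply: ltnW.
Qed.

Lemma prod_enum (w : 'I_d -> R) :
  \prod_(x <- [seq w i | i <- enum 'I_d]) ('X - x%:P) =
  \prod_(i < d) ('X - (w i)%:P).
Proof. by rewrite big_map big_enum. Qed.

Lemma eigvals_uniq X u v : is_eigvals X u -> is_eigvals X v -> u = v.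
Proof.
move=> [umon Xu] [vmon Xv].
have E : [seq u 0 i | i <- enum 'I_d] = [seq v 0 i | i <- enum 'I_d].
  apply: (@sorted_eq _ (>=%R : rel R)).
  - by move=> y x z /= xy yz; apply: le_trans yz xy.
  - by move=> x y /= xy; apply/eqP; rewrite eq_le andbC.
  - exact: nonincreasing_sorted.
  - exact: nonincreasing_sorted.
  apply: (@prod_XsubC_eq R).
  by rewrite !prod_enum -Xu -Xv.
apply/rowP => i.
have := congr1 (fun s => nth 0 s i) E.
by rewrite /= (nth_map i) ?size_enum_ord// (nth_map i) ?size_enum_ord// nth_ord_enum.
Qed.

Lemma eigvalsP X : symmetric_mx X -> is_eigvals X (eigvals X).
Proof.
move=> Xsym; rewrite /eigvals; case: xgetP => [_ -> //|noX]; exfalso.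
pose toC := real_complex R; pose A := map_mx toC X.
have Aherm : A \is hermsymmx.
  apply/is_hermitianmxP; rewrite expr0 scale1r; apply/matrixP => i j.
  by rewrite !mxE -{1}Xsym mxE; apply/esym/CrealP; rewrite complex_real.
have Areal := hermitian_spectral_diag_real Aherm.
have /orthomx_spectralP := hermitian_normalmx Aherm.
have := spectral_unit A; move: Areal.
set P := spectralmx A; set D := spectral_diag A => Dreal Punit AE.
have charA : char_poly A = \prod_(i < d) ('X - (D 0 i)%:P).
  have -> : char_poly A = char_poly (diag_mx D).
    pose Q := map_mx polyC P; pose Q' := map_mx polyC (invmx P).
    have Q'Q : Q' *m Q = 1%:M by rewrite -map_mxM mulVmx// map_mx1.
    have E : char_poly_mx A = Q' *m char_poly_mx (diag_mx D) *m Q.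
      rewrite /char_poly_mx mulmxBr mulmxBl AE !map_mxM; congr (_ - _).
      by rewrite scalar_mxC -mulmxA Q'Q mulmx1.
    rewrite /char_poly E !det_mulmx mulrAC -det_mulmx Q'Q det1 mul1r//.
  rewrite char_poly_trig ?diag_mx_is_trig//.
  by apply: eq_bigr => i _; rewrite mxE eqxx mulr1n.
pose w i := complex.Re (D 0 i).
have charX : char_poly X = \prod_(i < d) ('X - (w i)%:P).
  apply: (@map_poly_inj _ _ toC); rewrite map_char_poly -/A charA rmorph_prod.
  apply: eq_bigr => i _; rewrite rmorphB /= map_polyX map_polyC /=.
  by rewrite /w RRe_real//; have /mxOverP := Dreal; apply.
pose t := sort >=%R [seq w i | i <- enum 'I_d].
have tsize : size t = d by rewrite size_sort size_map size_enum_ord.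
have tsorted : sorted >=%R t by apply: sort_sorted => x y; apply: le_total.
apply: (noX (\row_i t`_i)); split => [i j ij|].
  rewrite !mxE.
  have getr : transitive (>=%R : rel R).
    by move=> y x z /= xy yz; apply: le_trans yz xy.
  by apply: (sorted_leq_nth getr (@lexx _ R) 0 tsorted); rewrite ?inE ?tsize.
have tperm : perm_eq [seq w i | i <- enum 'I_d] t by rewrite perm_sym perm_sort.
rewrite charX -(prod_enum w) (perm_big t tperm) /=.
by rewrite (big_nth 0) tsize big_mkord; apply: eq_bigr => i _; rewrite mxE.
Qed.

End Eigenvalues.

(* The convex hull, as the smallest convex set containing A. *)
Definition conv_hull (R : realType) (M : lmodType R) (A : set M) : set M :=
  smallest (@convex_set R M) A.

Section Epigraphs.
Variables (R : realType) (phi : R -> R).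
Local Open Scope ereal_scope.

Definition phi_ext (x : R) : \bar R := if (0 < x)%R then (phi x)%:E else +oo.

Variables (d s : nat).

Definition f_s (xi : 'rV[R]_d) : \bar R := \sum_(i < d | (i < s)%N) phi_ext (xi 0%R i).

(* The minimum is rendered as an infimum in \bar R, which presupposes neither
   feasibility nor attainment. *)
Definition g_s (lambda : 'rV[R]_d) : \bar R :=
  ereal_inf [set f_s xi | xi in [set xi : 'rV[R]_d |
    [/\ nonneg_vec xi, majorizes xi lambda & nonincreasing_vec xi]]].

Definition dom_s : set 'M[R]_d := [set X | psd_mx X /\ (s <= \rank X)%N].

Definition F_s (X : 'M[R]_d) : \bar R := if X \in dom_s then f_s (eigvals X) else +oo.

Definition G_s (X : 'M[R]_d) : \bar R := if X \in dom_s then g_s (eigvals X) else +oo.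

Definition Omega_bar : set ('rV[R]_d * 'M[R]_d) :=
  [set p | [/\ nonneg_vec p.1, psd_mx p.2, p.1 = eigvals p.2 & nonincreasing_vec p.1]].

Definition Omega_hat : set ('rV[R]_d * 'M[R]_d) :=
  [set p | [/\ nonneg_vec p.1, psd_mx p.2, majorizes p.1 (eigvals p.2)
             & nonincreasing_vec p.1]].

End Epigraphs.

(* Functions on the symmetric matrices are given on all of 'M_d, so the
   ambient space of the epigraph is cut down to R x S^d explicitly. *)
Definition epi (R : realType) (d : nat) (F : 'M[R]_d -> \bar R) :
    set (R^o * 'M[R]_d) :=
  [set p | symmetric_mx p.2 /\ (F p.2 <= p.1%:E)%E].

(* Main.v *)
Require Import Defs.
From mathcomp Require Import all_boot all_order all_algebra all_fingroup.
From mathcomp Require Import all_classical all_reals all_analysis.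
From mathcomp Require Import ring lra.
Import Order.TTheory GRing.Theory Num.Theory.
Import numFieldNormedType.Exports.
Local Open Scope classical_set_scope.
Local Open Scope ring_scope.
Set Implicit Arguments.
Unset Strict Implicit.
Unset Printing Implicit Defensive.

(** The two descriptions of the epigraphs come from unfolding the domain
    condition. For a positive semidefinite X, rank at least s means that the
    first s eigenvalues are positive ([le_rank_eigvals]), and finiteness of
    f_s xi means that the first s entries of xi are positive ([f_s_leP]). If xi
    majorizes the eigenvalues, the former follows from the latter
    ([majorized_pos]): were the i-th eigenvalue zero for some i < s, the
    eigenvalues before it would already carry the whole trace, which the
    corresponding entries of xi, followed by a positive one, cannot reach.
    Conversely, a real upper bound on the infimum g_s is met by some xi, since
    the nonincreasing nonnegative majorants of a vector form a compact set and
    f_s is lower semicontinuous ([compact_lsc_attained]).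

    The set epi G_s contains epi F_s and is convex. Convexity is read off its
    description with xi: a combination of majorants of the eigenvalues of X and
    Y majorizes the eigenvalues of the same combination of X and Y, by
    Ky Fan's inequality ([ky_fan], [majorizes_eigvals_comb]), and f_s is convex.

    For the other inclusion, let xi majorize the eigenvalues of
    X = U^T diag(eigvals X) U, with f_s xi <= t. Then eigvals X lies in every
    convex set containing all the permutations of xi ([majorization_convex]).
    The matrices U^T diag(v) U, for v a permutation of xi, all have the sorted
    eigenvalues xi, so that (t, U^T diag(v) U) is in epi F_s for each of them,
    and (t, X) is in the convex hull of these points.

    Both steps rest on the spectral theorem for real symmetric matrices,
    obtained here with eigenvalues in a prescribed order
    ([spectral_symmetric]). *)

(** * Orthogonal matrices and the real spectral theorem *)

Definition orthogonal_mx (R : pzRingType) n (U : 'M[R]_n) := U *m U^T = 1%:M.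

Lemma orthogonal_mxC (R : comUnitRingType) n (U : 'M[R]_n) :
  orthogonal_mx U -> U^T *m U = 1%:M.
Proof. exact: mulmx1C. Qed.

Lemma orthogonal_mxM (R : comPzRingType) n (U V : 'M[R]_n) :
  orthogonal_mx U -> orthogonal_mx V -> orthogonal_mx (U *m V).
Proof.
rewrite /orthogonal_mx => UU VV.
by rewrite trmx_mul mulmxA -(mulmxA U) VV mulmx1.
Qed.

Lemma char_poly_conj (R : comNzRingType) n (A P Q : 'M[R]_n) :
  Q *m P = 1%:M -> char_poly (Q *m A *m P) = char_poly A.
Proof.
move=> QP.
have {}QP : map_mx (@polyC R) Q *m map_mx (@polyC R) P = 1%:M.
  by rewrite -map_mxM QP map_mx1.
have E : char_poly_mx (Q *m A *m P) =
    map_mx (@polyC R) Q *m char_poly_mx A *m map_mx (@polyC R) P.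
  rewrite /char_poly_mx mulmxBr mulmxBl !map_mxM; congr (_ - _).
  by rewrite scalar_mxC -mulmxA QP mulmx1.
by rewrite /char_poly E !det_mulmx mulrAC -det_mulmx QP det1 mul1r.
Qed.

Lemma char_poly_diag (R : comNzRingType) n (v : 'rV[R]_n) :
  char_poly (diag_mx v) = \prod_(i < n) ('X - (v 0 i)%:P).
Proof.
rewrite char_poly_trig ?diag_mx_is_trig//.
by apply: eq_bigr => i _; rewrite mxE eqxx mulr1n.
Qed.

Lemma mulmx_tr_self (R : comPzRingType) n (u : 'rV[R]_n) :
  (u *m u^T) 0 0 = \sum_i u 0 i ^+ 2.
Proof. by rewrite mxE; apply: eq_bigr => i _; rewrite mxE expr2. Qed.

(** Q is the reflection that exchanges u with the first basis vector e; it is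
    symmetric and orthogonal. When u = e there is nothing to reflect along. *)
Lemma householder (R : realFieldType) n (u : 'rV[R]_n.+1) :
  u *m u^T = 1%:M -> exists2 Q : 'M[R]_n.+1, orthogonal_mx Q & row 0 Q = u.
Proof.
move=> uu; pose e : 'rV[R]_n.+1 := delta_mx 0 0.
have [w wE] : exists w, w = u - e by exists (u - e).
have [w0|w_neq0] := eqVneq w 0.
  exists 1%:M; first by rewrite /orthogonal_mx trmx1 mulmx1.
  by rewrite rowE mulmx1; apply/esym/eqP; rewrite -subr_eq0 -/e -wE w0.
pose c := (w *m w^T) 0 0.
have cE : w *m w^T = c%:M by rewrite /c -mx11_scalar.
have ee : e *m e^T = 1%:M.
  by apply/matrixP => i j; rewrite !ord1 trmx_delta mul_delta_mx !mxE.
have ue : u *m e^T = (u 0 0)%:M.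
  by apply/matrixP => i j; rewrite !ord1 trmx_delta -colE !mxE.
have eu : e *m u^T = (u 0 0)%:M.
  by rewrite -[LHS]trmxK trmx_mul trmxK ue tr_scalar_mx.
have c2 : c = 2 * (1 - u 0 0).
  rewrite /c wE linearB /= mulmxBl !mulmxBr uu ee ue eu !mxE /=.
  by ring.
have c_neq0 : c != 0.
  apply: contra w_neq0; rewrite /c mulmx_tr_self => /eqP w0.
  apply/eqP/rowP => i; rewrite [RHS]mxE; apply/eqP; rewrite -sqrf_eq0.
  have /psumr_eq0P := w0 => -> //.
  by move=> j _; exact: sqr_ge0.
pose Q := 1%:M - (2 / c) *: (w^T *m w).
have QT : Q^T = Q by rewrite /Q linearB /= linearZ /= trmx_mul trmxK trmx1.
exists Q.
  rewrite /orthogonal_mx QT /Q mulmxBl mul1mx mulmxBr mulmx1.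
  rewrite -scalemxAl -scalemxAr mulmxA -(mulmxA w^T) cE mul_mx_scalar.
  rewrite -scalemxAl !scalerA.
  rewrite (_ : 2 / c * (2 / c * c) = 2 / c + 2 / c); last first.
    by rewrite divfK //; ring.
  by rewrite scalerDl opprB addrK subrK.
rewrite rowE -/e /Q mulmxBr mulmx1 -scalemxAr mulmxA.
rewrite {1}wE linearB /= mulmxBr eu ee -raddfB /= mul_scalar_mx scalerA.
have -> : 2 / c * (u 0 0 - 1) = -1.
  rewrite (_ : u 0 0 - 1 = - (c / 2)); last by rewrite c2; field.
  by field.
by rewrite scaleN1r opprK wE addrC subrK.
Qed.

(** Deflation by induction on n. An eigenvector for v 0, normalized, is the
    first row of an orthogonal Q, and Q X Q^T is block diagonal because its
    first row is v 0 times a basis vector and it is symmetric. Cancelling the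
    factor 'X - v 0 in the characteristic polynomial gives the induction
    hypothesis for the lower right block. Prescribing the order of the
    eigenvalues spares a sorting step afterwards. *)
Lemma spectral_symmetric (R : rcfType) n (X : 'M[R]_n) (v : 'rV[R]_n) :
  X^T = X -> char_poly X = \prod_(i < n) ('X - (v 0 i)%:P) ->
  exists2 U : 'M[R]_n, orthogonal_mx U & X = U^T *m diag_mx v *m U.
Proof.
elim: n X v => [|n IHn] X v Xsym charX.
  by exists 1%:M; [rewrite /orthogonal_mx trmx1 mulmx1|apply/matrixP => -[]].
pose a := v 0 0.
have /eigenvalueP [u0 u0X u0_neq0] : eigenvalue X a.
  rewrite eigenvalue_root_char charX big_ord_recl rootM.
  by rewrite root_XsubC eqxx.
pose N := \sum_i u0 0 i ^+ 2.
have N_gt0 : 0 < N.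
  rewrite lt_neqAle sumr_ge0 ?andbT; last by move=> i _; exact: sqr_ge0.
  apply: contra u0_neq0 => /eqP N0; apply/eqP/rowP => i; rewrite mxE; apply/eqP.
  rewrite -sqrf_eq0; have /psumr_eq0P := esym N0 => -> //.
  by move=> j _; exact: sqr_ge0.
pose u := (Num.sqrt N)^-1 *: u0.
have uu : u *m u^T = 1%:M.
  rewrite /u linearZ /= -scalemxAl -scalemxAr scalerA.
  rewrite [u0 *m _]mx11_scalar mulmx_tr_self -/N scale_scalar_mx; congr (_%:M).
  rewrite -invfM -expr2 sqr_sqrtr ?ltW// mulVf// gt_eqF//.
have uX : u *m X = a *: u by rewrite /u -scalemxAl u0X scalerA mulrC -scalerA.
have [Q QQ Qu] := householder uu.
have QQ' := orthogonal_mxC QQ.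
have [Y YQ] : exists Y : 'M[R]_(1 + n), Y = Q *m X *m Q^T.
  by exists (Q *m X *m Q^T).
have Ysym : Y^T = Y by rewrite YQ !trmx_mul trmxK Xsym mulmxA.
have Yrow : row 0 Y = a *: row 0 1%:M.
  by rewrite YQ !row_mul Qu uX -scalemxAl -Qu -row_mul QQ.
have YrowE i : Y 0 i = a *+ (0 == i).
  by have /rowP/(_ i) := Yrow; rewrite !mxE mulr_natr.
have Yur : ursubmx Y = 0.
  apply/matrixP => i j; rewrite !mxE !ord1.
  have -> : lshift n 0 = 0 :> 'I_(1 + n) by apply/val_inj.
  by rewrite YrowE.
have YE : Y = block_mx a%:M 0 0 (drsubmx Y).
  rewrite -[LHS](@submxK _ 1 n 1 n); congr block_mx => //.
    apply/matrixP => i j; rewrite !ord1 !mxE.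
    have -> : lshift n 0 = 0 :> 'I_(1 + n) by apply/val_inj.
    by rewrite YrowE.
  by rewrite -Ysym -trmx_ursub Yur trmx0.
pose v' : 'rV[R]_n := \row_i v 0 (lift 0 i).
have vE : v = row_mx (a%:M : 'rV[R]_1) v' :> 'rV_(1 + n).
  apply/rowP => i; rewrite mxE; case: splitP => j ij.
    rewrite ord1 !mxE eqxx mulr1n; congr (v 0 _).
    by apply/val_inj; rewrite /= ij ord1.
  by rewrite mxE; congr (v 0 _); apply/val_inj; rewrite /= ij.
have charY : char_poly Y = ('X - a%:P) * char_poly (drsubmx Y).
  rewrite YE {1}/char_poly /char_poly_mx map_block_mx.
  rewrite [X in X - _](scalar_mx_block 1 n) opp_block_mx add_block_mx.
  rewrite !map_mx0 !oppr0 !addr0 det_ublock map_scalar_mx.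
  by rewrite -raddfB det_scalar expr1 block_mxKdr.
have := IHn (drsubmx Y) v'.
have -> : (drsubmx Y)^T = drsubmx Y by rewrite trmx_drsub Ysym.
case=> //.
  have Xa : 'X - a%:P != 0 by rewrite polyXsubC_eq0.
  apply: (mulfI Xa); rewrite -charY YQ char_poly_conj // charX big_ord_recl.
  by congr (_ * _); apply: eq_bigr => i _; rewrite mxE.
move=> V VV drE.
pose W : 'M[R]_(1 + n) := block_mx 1%:M 0 0 V.
have WW : orthogonal_mx W.
  rewrite /orthogonal_mx tr_block_mx mulmx_block !trmx0 !mulmx0 !mul0mx.
  by rewrite !addr0 add0r trmx1 mulmx1 VV -scalar_mx_block.
exists (W *m Q); first exact: orthogonal_mxM.
have vE' : diag_mx v = block_mx a%:M 0 0 (diag_mx v') :> 'M[R]_(1 + n).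
  transitivity (diag_mx (row_mx (a%:M : 'rV[R]_1) v')); first by rewrite -vE.
  rewrite diag_mx_row; congr block_mx.
  by apply/matrixP => i j; rewrite !mxE !ord1 eqxx.
have YW : Y = W^T *m block_mx a%:M 0 0 (diag_mx v') *m W.
  rewrite YE drE /W tr_block_mx !mulmx_block !trmx0.
  by rewrite !(mulmx0, mul0mx, addr0, add0r) trmx1 mulmx1 mul1mx.
have -> : X = Q^T *m Y *m Q.
  by rewrite YQ !mulmxA QQ' mul1mx -mulmxA QQ' mulmx1.
by rewrite vE' YW trmx_mul !mulmxA.
Qed.

Lemma rank_diag_mx (F : fieldType) n (v : 'rV[F]_n) :
  \rank (diag_mx v) = (\sum_(i < n) (v 0 i != 0)%R)%N.
Proof.
elim: n v => [|n IHn] v; first by rewrite big_ord0 flatmx0 mxrank0.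
rewrite big_ord_recl.
pose v' : 'rV[F]_n := \row_i v 0 (lift 0 i).
have E : diag_mx v = block_mx ((v 0 0)%:M : 'M[F]_1) 0 0 (diag_mx v')
    :> 'M[F]_(1 + n).
  apply/matrixP => i j; rewrite !mxE; case: splitP => i' ii'; rewrite !mxE;
    case: splitP => j' jj'; rewrite !mxE ?ord1.
  - rewrite -!(inj_eq val_inj) /= ii' jj' !ord1; congr (v 0 _ *+ _).
    by apply/val_inj; rewrite /= ii' ord1.
  - by rewrite -!(inj_eq val_inj) /= ii' jj' !ord1.
  - by rewrite -!(inj_eq val_inj) /= ii' jj' !ord1.
  - rewrite -!(inj_eq val_inj) /= ii' jj'; congr (v 0 _ *+ _).
    by apply/val_inj; rewrite /= ii'.
transitivity (\rank (block_mx ((v 0 0)%:M : 'M[F]_1) 0 0 (diag_mx v'))).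
  by rewrite -E.
rewrite rank_diag_block_mx rank_rV IHn; congr (_ + _)%N.
  by rewrite -scalemx1 scaler_eq0 oner_eq0 orbF.
by apply: eq_bigr => i _; rewrite mxE.
Qed.

Lemma mxrank_conj (F : fieldType) n (A U : 'M[F]_n) :
  U \in unitmx -> \rank (U^T *m A *m U) = \rank A.
Proof.
move=> Uu; rewrite mxrankMfree ?row_free_unit// -mxrank_tr trmx_mul trmxK.
by rewrite mxrankMfree ?row_free_unit// mxrank_tr.
Qed.

Lemma orthogonal_mx_unit (R : comUnitRingType) n (U : 'M[R]_n) :
  orthogonal_mx U -> U \in unitmx.
Proof. by move=> /mulmx1_unit[]. Qed.

Lemma orthogonal_mxT (R : comUnitRingType) n (U : 'M[R]_n) :
  orthogonal_mx U -> orthogonal_mx U^T.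
Proof. by move=> /orthogonal_mxC; rewrite /orthogonal_mx trmxK. Qed.

(** The squared entries of an orthogonal W are the doubly stochastic weights
    behind the Schur-Horn and Ky Fan inequalities. *)
Lemma conj_diag_mxE (R : comPzRingType) n (W : 'M[R]_n) (v : 'rV[R]_n) i :
  (W *m diag_mx v *m W^T) i i = \sum_j W i j ^+ 2 * v 0 j.
Proof.
rewrite mul_mx_diag mxE; apply: eq_bigr => j _; rewrite !mxE.
by rewrite mulrAC expr2.
Qed.

(** * Eigenvalues of real symmetric matrices *)

Section Eigenvalues.
Variables (R : realType) (d : nat).
Implicit Types (u v xi : 'rV[R]_d) (X U W : 'M[R]_d).

Lemma sum_largest_noninc v j : (j <= d)%N -> nonincreasing_vec v ->
  sum_largest j v = \sum_(i < d | (i < j)%N) v 0 i.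
Proof.
move=> jd /nonincreasing_sorted vs; rewrite /sum_largest sorted_sort //; last first.
  by move=> y x z /= xy yz; exact: le_trans yz xy.
have -> : take j [seq v 0 i | i <- enum 'I_d] =
    [seq v 0 i | i : 'I_d <- enum 'I_d & (i < j)%N].
  rewrite -map_take; congr map; apply: (inj_map val_inj).
  rewrite map_take -(filter_map _ (gtn j)) val_enum_ord take_iota (minn_idPl jd).
  by rewrite -(filter_iota_ltn 0 jd).
by rewrite big_map big_filter big_enum_cond.
Qed.

Lemma spectral_eigvals X : symmetric_mx X ->
  exists2 U, orthogonal_mx U & X = U^T *m diag_mx (eigvals X) *m U.
Proof.
by move=> Xs; have [_ charX] := eigvalsP Xs; exact: spectral_symmetric.
Qed.

(** The order of the diagonal entries does not affect the characteristic
    polynomial, and sorted eigenvalues are determined by it. *)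
Lemma eigvals_conj U v (s : 'S_d) : orthogonal_mx U -> nonincreasing_vec v ->
  eigvals (U^T *m diag_mx (\row_i v 0 (s i)) *m U) = v.
Proof.
move=> UU vmon; apply: (@eigvals_uniq _ _ _) (eigvalsP _) _.
  by rewrite /symmetric_mx !trmx_mul trmxK tr_diag_mx mulmxA.
split=> //; rewrite char_poly_conj; last exact: orthogonal_mxC.
rewrite char_poly_diag [RHS](reindex_inj (@perm_inj _ s)) /=.
by apply: eq_bigr => i _; rewrite mxE.
Qed.

Lemma psd_conj U v : nonneg_vec v -> psd_mx (U^T *m diag_mx v *m U).
Proof.
move=> v0; split.
  by rewrite /symmetric_mx !trmx_mul trmxK tr_diag_mx mulmxA.
move=> w; rewrite !mulmxA -trmx_mul -mulmxA mul_mx_diag mxE.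
apply: sumr_ge0 => i _; rewrite !mxE mulrAC mulr_ge0//.
by rewrite -expr2 sqr_ge0.
Qed.

Lemma eigvals_nonneg X : psd_mx X -> nonneg_vec (eigvals X).
Proof.
move=> [Xs Xpos] i; have [U UU XE] := spectral_eigvals Xs.
have -> : eigvals X 0 i = (U *m X *m U^T) i i.
  rewrite {2}XE !mulmxA UU mul1mx -mulmxA UU mulmx1 mxE eqxx mulr1n//.
have := Xpos (row i U)^T; rewrite trmxK -row_mul.
have -> : (row i (U *m X) *m (row i U)^T) 0 0 = (U *m X *m U^T) i i.
  by rewrite !mxE; apply: eq_bigr => j _; rewrite !mxE.
by [].
Qed.

Lemma sum_ord_lt s : (s <= d)%N -> (\sum_(i < d) (i < s)%N)%N = s.
Proof.
move=> sd; rewrite -[RHS](card_ord s) -sum1_card.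
by rewrite (big_ord_widen d (fun=> 1%N) sd) [RHS]big_mkcond.
Qed.

Lemma le_rank_diag s v : (s <= d)%N -> nonneg_vec v -> nonincreasing_vec v ->
  (s <= \rank (diag_mx v))%N <-> (forall i : 'I_d, (i < s)%N -> 0 < v 0 i).
Proof.
move=> sd v0 vmon; rewrite rank_diag_mx; split=> [sr i i_s|vpos]; last first.
  rewrite -{1}(sum_ord_lt sd); apply: leq_sum => i _.
  by case: ltnP => // /vpos; rewrite lt0r => /andP[->].
rewrite lt0r v0 andbT; apply: contraTneq sr => vi0; rewrite -ltnNge.
apply: leq_ltn_trans i_s; rewrite -[leqRHS](sum_ord_lt (ltnW (ltn_ord i))).
apply: leq_sum => j _; case: (ltnP j i) => [_|ij]; first exact: leq_b1.
suff -> : v 0 j = 0 by rewrite eqxx.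
by apply/eqP; rewrite eq_le v0 andbT -vi0 vmon.
Qed.

Lemma le_rank_eigvals X s : psd_mx X -> (s <= d)%N ->
  (s <= \rank X)%N <-> (forall i : 'I_d, (i < s)%N -> 0 < eigvals X 0 i).
Proof.
move=> Xpsd sd; have [Xs _] := Xpsd; have [emon _] := eigvalsP Xs.
have [U UU XE] := spectral_eigvals Xs.
rewrite {1}XE mxrank_conj; last exact: orthogonal_mx_unit.
exact: le_rank_diag sd (eigvals_nonneg Xpsd) emon.
Qed.

(** The left-hand side is a weighted sum of the entries of v with weights c j
    in [0, 1] that sum to k. Subtracting v k from every entry changes both
    sides by the same amount, after which the inequality holds term by term:
    entries before k are nonnegative and weigh at most 1, the others are
    nonpositive and weigh at least 0. *)
Lemma ky_fan W v (k : 'I_d) : orthogonal_mx W -> nonincreasing_vec v ->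
  \sum_(i < d | (i < k)%N) (W *m diag_mx v *m W^T) i i <=
  \sum_(i < d | (i < k)%N) v 0 i.
Proof.
move=> WW vmon.
pose c j := \sum_(i < d | (i < k)%N) W i j ^+ 2.
have row1 i : \sum_j W i j ^+ 2 = 1.
  have /matrixP/(_ i i) := WW; rewrite !mxE eqxx mulr1n => <-.
  by apply: eq_bigr => j _; rewrite mxE expr2.
have c0 j : 0 <= c j by apply: sumr_ge0 => i _; exact: sqr_ge0.
have c1 j : c j <= 1.
  have /matrixP/(_ j j) := orthogonal_mxC WW; rewrite !mxE eqxx mulr1n => <-.
  rewrite /c big_mkcond; apply: ler_sum => i _; rewrite mxE -expr2.
  by case: ifP => // _; exact: sqr_ge0.
have csum : \sum_j c j = \sum_(i < d) (i < k)%:R.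
  rewrite /c exchange_big /= big_mkcond; apply: eq_bigr => i _.
  by case: ifP => // _; rewrite row1.
have -> : \sum_(i < d | (i < k)%N) (W *m diag_mx v *m W^T) i i =
    \sum_j c j * v 0 j.
  under eq_bigr do rewrite conj_diag_mxE.
  by rewrite exchange_big; apply: eq_bigr => j _; rewrite /c mulr_suml.
rewrite -subr_le0 [X in _ - X]big_mkcond /= -sumrB.
have -> : \sum_(i < d) (c i * v 0 i - (if (i < k)%N then v 0 i else 0)) =
    \sum_i (c i - (i < k)%:R) * (v 0 i - v 0 k).
  rewrite [RHS](eq_bigr (fun i : 'I_d =>
    (c i * v 0 i - (if (i < k)%N then v 0 i else 0)) - (c i - (i < k)%:R) * v 0 k)).
    by rewrite [RHS]sumrB -mulr_suml [X in _ - X * _]sumrB csum subrr mul0r subr0.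
  by move=> i _; case: (i < k)%N => /=; ring.
apply: sumr_le0 => i _; case: ltnP => ik /=.
  by rewrite mulr_le0_ge0// ?subr_le0// subr_ge0 vmon// ltnW.
by rewrite subr0 mulr_ge0_le0// subr_le0 vmon.
Qed.

End Eigenvalues.

(** * Prefix sums and majorization *)

Section Majorization.
Variables (R : realType) (d : nat).
Implicit Types (u v xi : 'rV[R]_d) (X U W : 'M[R]_d).

(** On a nonincreasing vector this is the sum of the j largest entries, but
    unlike that sum it is linear in v. *)
Definition prefix_sum v (j : nat) : R := \sum_(i < d | (i < j)%N) v 0 i.

Lemma prefix_sum_full v j : (d <= j)%N -> prefix_sum v j = \sum_i v 0 i.
Proof. by move=> dj; apply: eq_bigl => i; rewrite (leq_trans (ltn_ord i) dj). Qed.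

Lemma prefix_sum_comb a b u v j :
  prefix_sum (a *: u + b *: v) j = a * prefix_sum u j + b * prefix_sum v j.
Proof.
rewrite /prefix_sum !mulr_sumr -big_split; apply: eq_bigr => i _.
by rewrite !mxE.
Qed.

Lemma majorizes_prefix_sum u v : nonincreasing_vec u -> nonincreasing_vec v ->
  majorizes u v <->
  prefix_sum u d = prefix_sum v d /\ forall j, prefix_sum v j <= prefix_sum u j.
Proof.
move=> um vm; rewrite !prefix_sum_full//; split=> -[uv uv']; split=> // j.
  have [dj|jd] := leqP d j; first by rewrite !prefix_sum_full// uv.
  by rewrite /prefix_sum -!sum_largest_noninc ?(ltnW jd)//; exact: uv'.
by move=> jd; rewrite !sum_largest_noninc ?(ltnW jd)//; exact: uv'.
Qed.

Lemma prefix_sum_eigvals_trace X : symmetric_mx X -> prefix_sum (eigvals X) d = \tr X.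
Proof.
move=> /spectral_eigvals[U UU XE]; rewrite [in RHS]XE mxtrace_mulC mulmxA UU.
by rewrite mul1mx mxtrace_diag prefix_sum_full.
Qed.

Lemma nonincreasing_comb a b u v : 0 <= a -> 0 <= b ->
  nonincreasing_vec u -> nonincreasing_vec v -> nonincreasing_vec (a *: u + b *: v).
Proof.
by move=> a0 b0 um vm i j ij; rewrite !mxE lerD// ler_wpM2l// ?um// vm.
Qed.

Lemma symmetric_comb a b X Y : symmetric_mx X -> symmetric_mx Y ->
  symmetric_mx (a *: X + b *: Y).
Proof.
by rewrite /symmetric_mx => Xs Ys; rewrite linearD /= !linearZ /= Xs Ys.
Qed.

Lemma psd_comb a b X Y : 0 <= a -> 0 <= b -> psd_mx X -> psd_mx Y ->
  psd_mx (a *: X + b *: Y).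
Proof.
move=> a0 b0 [Xs X0] [Ys Y0]; split; first exact: symmetric_comb.
move=> w; rewrite mulmxDr mulmxDl -!scalemxAr -!scalemxAl mxE.
by apply: addr_ge0; rewrite mxE; apply: mulr_ge0.
Qed.

Lemma ky_fan_eigvals X U (k : 'I_d) : symmetric_mx X -> orthogonal_mx U ->
  \sum_(i < d | (i < k)%N) (U *m X *m U^T) i i <= prefix_sum (eigvals X) k.
Proof.
move=> Xs UU; have [V VV XE] := spectral_eigvals Xs.
have -> : U *m X *m U^T = (U *m V^T) *m diag_mx (eigvals X) *m (U *m V^T)^T.
  by rewrite {1}XE trmx_mul trmxK !mulmxA.
apply: ky_fan; last by have [] := eigvalsP Xs.
by apply: orthogonal_mxM => //; exact: orthogonal_mxT.
Qed.

(** In an orthonormal eigenbasis U of aX + bY, the sum of its k largest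
    eigenvalues is the same combination of partial traces of U X U^T and
    U Y U^T, each of which is bounded by Ky Fan's inequality. *)
Lemma majorizes_eigvals_comb a b X Y u v : 0 <= a -> 0 <= b ->
  symmetric_mx X -> symmetric_mx Y -> nonincreasing_vec u -> nonincreasing_vec v ->
  majorizes u (eigvals X) -> majorizes v (eigvals Y) ->
  majorizes (a *: u + b *: v) (eigvals (a *: X + b *: Y)).
Proof.
move=> a0 b0 Xs Ys um vm.
have [Xm _] := eigvalsP Xs; have [Ym _] := eigvalsP Ys.
have Zs := symmetric_comb a b Xs Ys; have [Zm _] := eigvalsP Zs.
move=> /(majorizes_prefix_sum um Xm)[uX uXj] /(majorizes_prefix_sum vm Ym)[vY vYj].
have eqd : prefix_sum (a *: u + b *: v) d = prefix_sum (eigvals (a *: X + b *: Y)) d.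
  by rewrite prefix_sum_comb uX vY !prefix_sum_eigvals_trace// linearD /= !linearZ.
apply/majorizes_prefix_sum => //; first exact: nonincreasing_comb.
split=> // j; have [dj|jd] := leqP d j.
  by move: eqd; rewrite !prefix_sum_full// => ->.
have [U UU ZE] := spectral_eigvals Zs.
have -> : prefix_sum (eigvals (a *: X + b *: Y)) j =
    \sum_(i < d | (i < j)%N) (U *m (a *: X + b *: Y) *m U^T) i i.
  rewrite [in RHS]ZE !mulmxA UU mul1mx; apply: eq_bigr => i _.
  by rewrite -mulmxA UU mulmx1 mxE eqxx mulr1n.
have -> : \sum_(i < d | (i < j)%N) (U *m (a *: X + b *: Y) *m U^T) i i =
    a * \sum_(i < d | (i < j)%N) (U *m X *m U^T) i i +
    b * \sum_(i < d | (i < j)%N) (U *m Y *m U^T) i i.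
  rewrite !mulr_sumr -big_split; apply: eq_bigr => i _.
  by rewrite mulmxDr mulmxDl -!scalemxAr -!scalemxAl mxE; congr (_ + _); rewrite mxE.
rewrite prefix_sum_comb lerD// ler_wpM2l//.
  exact: le_trans (ky_fan_eigvals (Ordinal jd) Xs UU) (uXj j).
exact: le_trans (ky_fan_eigvals (Ordinal jd) Ys UU) (vYj j).
Qed.

(** Rado's theorem, with the convex hull of the permutations of xi replaced by
    an arbitrary convex set closed under transpositions. The proof is that of
    Hardy, Littlewood and Polya: as long as xi differs from v, let k be the
    first index with xi k < v k, and j < k one with v j < xi j. Moving the
    amount e from entry j to entry k, with e as large as possible without
    crossing v, averages xi with its image under the transposition (j k), keeps
    the prefix sums above those of v, and makes one more entry agree with v.
    Only v has to be sorted, so the intermediate vectors need no reordering. *)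
Lemma majorization_convex (C : set 'rV[R]_d) xi v :
  (forall x y p, 0 <= p <= 1 -> C x -> C y -> C (p *: x + (1 - p) *: y)) ->
  (forall x i j, C x -> C (\row_k x 0 (tperm i j k))) ->
  nonincreasing_vec v ->
  prefix_sum xi d = prefix_sum v d -> (forall j, prefix_sum v j <= prefix_sum xi j) ->
  C xi -> C v.
Proof.
move=> Cconv Cperm vmon.
have [n] := ubnP #|[pred i | xi 0 i != v 0 i]|.
elim: n xi => // n IHn xi /ltnSE len xid xiv Cxi.
have [/existsP[k0 k0P]|/existsPn nolt] := boolP [exists k, xi 0 k < v 0 k]; last first.
  suff -> : v = xi by [].
  have ge i : 0 <= xi 0 i - v 0 i by rewrite subr_ge0 leNgt nolt.
  have /psumr_eq0P eq0 : \sum_i (xi 0 i - v 0 i) = 0.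
    by rewrite sumrB -!(prefix_sum_full _ (leqnn d)) xid subrr.
  by apply/rowP => i; apply/esym/eqP; rewrite -subr_eq0 eq0.
case: (@arg_minnP _ k0 (fun k => xi 0 k < v 0 k) (fun k => k : nat) k0P) => k kP kmin.
have kge (i : 'I_d) : (i < k)%N -> v 0 i <= xi 0 i.
  by move=> ik; rewrite leNgt; apply: contraTN ik => /kmin; rewrite -leqNgt.
(* Otherwise xi would not exceed v before k, and would be below it at k: the
   prefix sum of length k + 1 would be too small. *)
have [j jk jP] : exists2 j : 'I_d, (j < k)%N & v 0 j < xi 0 j.
  apply: contrapT => noj.
  have := xiv k.+1; apply/negP; rewrite -ltNge /prefix_sum.
  rewrite (bigD1 k) //= [ltRHS](bigD1 k) //= ltr_leD// ler_sum// => i /andP[ik neq_ik].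
  rewrite leNgt; apply/negP => lti; apply: noj; exists i => //.
  by rewrite ltn_neqAle -ltnS ik andbT; exact: neq_ik.
have neq_jk : j != k by apply: contraTneq jk => ->; rewrite ltnn.
pose e := Num.min (xi 0 j - v 0 j) (v 0 k - xi 0 k).
have e_gt0 : 0 < e by rewrite lt_min !subr_gt0 jP.
have ej : e <= xi 0 j - v 0 j by rewrite ge_min lexx.
have ek : e <= v 0 k - xi 0 k by rewrite ge_min lexx orbT.
have vjk : v 0 k <= v 0 j by apply: vmon; exact: ltnW.
pose D := xi 0 j - xi 0 k.
have De : e < D by rewrite /D; lra.
have D_neq0 : D != 0 by rewrite gt_eqF// (lt_trans e_gt0).
(* With this coefficient the average of xi and its transposed copy takes e
   from entry j and gives it to entry k. *)
pose xi' := (1 - e / D) *: xi + (1 - (1 - e / D)) *: \row_i xi 0 (tperm j k i).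
have xi'E i : xi' 0 i = xi 0 i - (i == j)%:R * e + (i == k)%:R * e.
  rewrite !mxE; have [->|ij] := eqVneq i j.
    by rewrite tpermL (negPf neq_jk) /=; move: D_neq0; rewrite /D => D_neq0; field.
  have [->|ik] := eqVneq i k.
    by rewrite tpermR /=; move: D_neq0; rewrite /D => D_neq0; field.
  by rewrite tpermD 1?eq_sym//=; ring.
have psumE m : prefix_sum xi' m = prefix_sum xi m - (j < m)%:R * e + (k < m)%:R * e.
  have onehot (l : 'I_d) : \sum_(i < d | (i < m)%N) (i == l)%:R * e = (l < m)%:R * e.
    rewrite -mulr_suml; congr (_ * _); rewrite big_mkcond (bigD1 l) //= eqxx.
    rewrite big1 ?addr0; first by case: ifP.
    by move=> i /negPf ->; case: ifP.
  rewrite /prefix_sum -!onehot -sumrB -big_split /=.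
  by apply: eq_bigr => i _; rewrite xi'E.
apply: (IHn xi'); first last.
- apply: Cconv => //; last exact: Cperm.
  rewrite subr_ge0 gerBl ler_pdivrMr ?mul1r ?(ltW De) ?divr_ge0//=.
  + exact: ltW. + by rewrite ltW// (lt_trans e_gt0). + exact: lt_trans De.
- move=> m; rewrite psumE; case: (ltnP k m) => [km|mk].
    by rewrite (ltn_trans jk km) subrK.
  case: (ltnP j m) => [jm|mj]; last by rewrite !mul0r subr0 addr0.
  rewrite mul1r mul0r addr0 lerBrDr -lerBrDl /prefix_sum -sumrB (bigD1 j) //=.
  rewrite (le_trans ej)// lerDl sumr_ge0// => i /andP[im _].
  by rewrite subr_ge0 kge// (leq_trans im).
- by rewrite psumE !ltn_ord subrK.
(* Entry j or entry k now agrees with v, whichever attains the minimum e,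
   and the entries that agreed before are untouched. *)
apply: leq_trans len; apply: proper_card; apply/properP; split.
  apply/fintype.subsetP => i; rewrite !inE; apply: contraNneq => xiE.
  rewrite xi'E; have [ij|_] := eqVneq i j; first by rewrite -ij xiE ltxx in jP.
  have [ik|_] := eqVneq i k; first by rewrite -ik xiE ltxx in kP.
  by rewrite !mul0r subr0 addr0 xiE.
case: (leP (xi 0 j - v 0 j) (v 0 k - xi 0 k)) => [h|h].
  exists j; first by rewrite !inE gt_eqF.
  rewrite !inE negbK xi'E eqxx (negPf neq_jk) mul0r addr0 mul1r /e.
  by rewrite (min_idPl h) opprB addrC subrK.
exists k; first by rewrite !inE lt_eqF.
rewrite !inE negbK xi'E eqxx [k == j]eq_sym (negPf neq_jk) mul0r subr0 mul1r /e.
by rewrite (min_idPr (ltW h)) addrC subrK.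
Qed.

End Majorization.

(** * Lower semicontinuity and attainment *)

Section LowerSemicontinuity.
Variables (R : realType) (X : topologicalType).
Local Open Scope ereal_scope.

Lemma lsc_comp (Y : topologicalType) (f : Y -> \bar R) (h : X -> Y) :
  lower_semicontinuous f -> continuous h -> lower_semicontinuous (f \o h).
Proof.
move=> lscf ch x a /lscf[V Vhx Va].
by exists (h @^-1` V); [exact: ch | move=> y; exact: Va].
Qed.

(** Lets the neighborhoods on which each summand stays above its own bound
    be intersected, to bound a sum of lower semicontinuous functions. *)
Lemma lt_addeP (a : R) (x y : \bar R) : -oo < x -> -oo < y -> a%:E < x + y ->
  exists b c : R, [/\ b%:E < x, c%:E < y & a = (b + c)%R].
Proof.
case: x => [x| |]//; case: y => [y| |]// _ _.
- rewrite -EFinD lte_fin => axy; pose e := ((x + y - a) / 2)%R.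
  by exists (x - e)%R, (y - e)%R; rewrite !lte_fin /e; split; [lra|lra|field].
- by exists (x - 1)%R, (a - x + 1)%R; rewrite lte_fin ltry; split=> //; [lra|ring].
- by exists (a - y + 1)%R, (y - 1)%R; rewrite lte_fin ltry; split=> //; [lra|ring].
- by exists a, 0%R; rewrite !ltry addr0.
Qed.

Lemma lsc_sum (I : Type) (r : seq I) (P : pred I) (f : I -> X -> \bar R) :
  (forall i, lower_semicontinuous (f i)) -> (forall i x, -oo < f i x) ->
  lower_semicontinuous (fun x => \sum_(i <- r | P i) f i x).
Proof.
move=> lscf fNy; elim: r => [|i r IHr] x a.
  by rewrite big_nil => a0; exists setT; [exact: filterT|move=> y _; rewrite big_nil].
rewrite big_cons; case: ifPn => Pi; last first.
  by move=> /IHr[V Vx Va]; exists V => // y /Va; rewrite big_cons (negPf Pi).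
have sNy y : -oo < \sum_(j <- r | P j) f j y.
  apply: (big_ind (fun z : \bar R => -oo < z)) => //.
  by move=> [u| |] [v| |] // _ _; rewrite -EFinD ltNyr.
move=> /(lt_addeP (fNy _ _) (sNy _))[b [c [/lscf[V Vx Vb] /IHr[W Wx Wc] ->]]].
exists (V `&` W); first exact: filterI.
by move=> y [/Vb by_ /Wc cy]; rewrite big_cons Pi EFinD lteD.
Qed.

(** If f exceeded t on all of K, then each point of K would have a
    neighborhood on which f exceeds every real close enough to t from above;
    by compactness a single r > t would be a lower bound on K. *)
Lemma compact_lsc_attained (K : set X) (f : X -> \bar R) (t : R) :
  compact K -> lower_semicontinuous f ->
  ereal_inf (f @` K) <= t%:E -> exists2 x, K x & f x <= t%:E.
Proof.
move=> /compact_near_coveringP cK lscf inft; apply: contrapT => noK.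
have gtK x : K x -> t%:E < f x.
  by move=> Kx; rewrite ltNge; apply/negP => fxt; apply: noK; exists x.
have near_gt : \forall r \near t^'+, K `<=` (fun x => r%:E < f x).
  apply: cK => x /gtK tfx.
  have [r tr rfx] : exists2 r : R, (t < r)%R & r%:E < f x.
    case: (f x) tfx => [y| |]// ty; last by exists (t + 1)%R; rewrite ?ltry// ltrDl.
    exists ((t + y) / 2)%R; move: ty; rewrite !lte_fin; lra.
  have [V Vx Vr] := lscf _ _ rfx.
  exists (V, [set s | (s < r)%R]).
    by split => //=; exact: nbhs_right_lt.
  move=> [y s] /= [/Vr ry sr]; exact: lt_trans ry.
have [r [Kr /= tr]] := filter_ex (filterI near_gt (nbhs_right_gt t)).
have : r%:E <= ereal_inf (f @` K).
  by apply: le_ereal_inf_tmp => _ [x /Kr rfx <-]; exact: ltW.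
by move=> /le_trans/(_ inft); rewrite lee_fin leNgt tr.
Qed.

End LowerSemicontinuity.

(** * The objective function and its majorant sets *)

Section Objective.
Variables (R : realType) (phi : R -> R) (d s : nat).
Implicit Types (u v xi : 'rV[R]_d).

Lemma phi_ext_gtNy x : (-oo < phi_ext phi x)%E.
Proof. by rewrite /phi_ext; case: ifP; rewrite ?ltNyr. Qed.

Lemma lsc_f_s : lower_semicontinuous (phi_ext phi) ->
  lower_semicontinuous (@f_s R phi d s).
Proof.
move=> lscphi; apply: (@lsc_sum _ _ _ _ (fun i : 'I_d => (i < s)%N)
    (fun (i : 'I_d) (xi : 'rV[R]_d) => phi_ext phi (xi 0 i))) => [i|i xi].
  by apply: (lsc_comp lscphi); exact: coord_continuous.
exact: phi_ext_gtNy.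
Qed.

(** Finiteness of f_s forces positivity of the relevant entries, and turns the
    extended sum into a real one. *)
Lemma f_s_leP xi (t : R) : (f_s phi s xi <= t%:E)%E <->
  (forall i : 'I_d, (i < s)%N -> 0 < xi 0 i) /\
  \sum_(i < d | (i < s)%N) phi (xi 0 i) <= t.
Proof.
have f_sE : (forall i : 'I_d, (i < s)%N -> 0 < xi 0 i) ->
    f_s phi s xi = (\sum_(i < d | (i < s)%N) phi (xi 0 i))%:E.
  by move=> pos; rewrite -sumEFin; apply: eq_bigr => i /pos; rewrite /phi_ext => ->.
split=> [fxt|[pos]]; last by rewrite f_sE.
have pos (i : 'I_d) : (i < s)%N -> 0 < xi 0 i.
  move=> i_s; apply: contraLR fxt => xi0.
  rewrite /f_s (bigD1 i) //= {1}/phi_ext (negPf xi0) addye ?leye_eq//.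
  rewrite -ltNye; apply: (big_ind (fun z : \bar R => -oo < z)%E) => // [|j _].
    by move=> [x| |] [y| |] // _ _; rewrite -EFinD ltNyr.
  exact: phi_ext_gtNy.
by split=> //; rewrite -lee_fin -f_sE.
Qed.

Lemma f_s_convex u v p a b :
  convex_function (`]0, +oo[%classic : set R^o) phi -> 0 <= p <= 1 ->
  (f_s phi s u <= a%:E)%E -> (f_s phi s v <= b%:E)%E ->
  (f_s phi s (p *: u + (1 - p) *: v) <= (p * a + (1 - p) * b)%:E)%E.
Proof.
move=> cphi /andP[p0 p1] /f_s_leP[upos ua] /f_s_leP[vpos vb]; apply/f_s_leP.
have conv_phi x y : 0 < x -> 0 < y ->
    0 < p * x + (1 - p) * y /\
    phi (p * x + (1 - p) * y) <= p * phi x + (1 - p) * phi y.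
  move=> x0 y0; split; last first.
    by apply: (cphi (Itv01 p0 p1)); rewrite inE /= in_itv /= andbT.
  by apply: (@convR_gt0 _ x y (Itv01 p0 p1)).
split=> [i i_s|].
  by rewrite !mxE; have [] := conv_phi _ _ (upos i i_s) (vpos i i_s).
apply: (@le_trans _ _ (p * (\sum_(i < d | (i < s)%N) phi (u 0 i)) +
    (1 - p) * (\sum_(i < d | (i < s)%N) phi (v 0 i)))).
  rewrite !mulr_sumr -big_split /=; apply: ler_sum => i i_s.
  by rewrite !mxE; have [] := conv_phi _ _ (upos i i_s) (vpos i i_s).
by rewrite lerD// ler_wpM2l// subr_ge0.
Qed.

End Objective.

Section Feasible.
Variables (R : realType) (d : nat).
Implicit Types (u v xi : 'rV[R]_d).

Definition majorant_set v : set 'rV[R]_d := [set xi : 'rV[R]_d |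
    [/\ nonneg_vec xi, majorizes xi v & nonincreasing_vec xi]].

Lemma continuous_prefix_sum j : continuous (fun v : 'rV[R]_d => prefix_sum v j).
Proof.
by apply: continuous_big => [|i _]; [exact: add_continuous|exact: coord_continuous].
Qed.

Lemma closed_le_fun (T : topologicalType) (f g : T -> R) :
  continuous f -> continuous g -> closed [set x | f x <= g x].
Proof.
move=> cf cg.
have -> : [set x | f x <= g x] = (fun x => g x - f x) @^-1` [set y | 0 <= y].
  by apply/seteqP; split=> x /=; rewrite subr_ge0.
apply: preimage_closed; last exact: closed_ge.
by move=> x _; apply: cvgB; [exact: cg|exact: cf].
Qed.

(** All conditions are closed, and each entry of a majorant is bounded by the
    total sum of v. *)
Lemma compact_majorant_set v : nonincreasing_vec v -> compact (majorant_set v).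
Proof.
move=> vmon; pose M := prefix_sum v d.
pose box := [set xi : 'rV[R]_d | forall i, `[0, M]%classic (xi 0 i)].
pose mono := \bigcap_(ij in [set ij : 'I_d * 'I_d | (ij.1 <= ij.2)%N])
  [set xi : 'rV[R]_d | xi 0 ij.2 <= xi 0 ij.1].
pose maj := \bigcap_(j in [set: nat]) [set xi : 'rV[R]_d | prefix_sum v j <= prefix_sum xi j].
pose tot := [set xi : 'rV[R]_d | prefix_sum xi d <= M].
have -> : majorant_set v = box `&` (mono `&` (maj `&` tot)).
  apply/seteqP; split=> xi /=.
    move=> [xi0 xiv ximon]; have /majorizes_prefix_sum-/(_ ximon vmon)[eqd xij] := xiv.
    split; last split=> [[i j] /= ij|]; first last.
    - by split=> [j _|]; [exact: xij|rewrite /tot /= eqd].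
    - exact: ximon.
    move=> i /=; rewrite in_itv /= xi0 /= /M -eqd prefix_sum_full// (bigD1 i) //=.
    by rewrite lerDl sumr_ge0.
  move=> [xi_box [xi_mono [xi_maj xi_tot]]].
  have xi0 : nonneg_vec xi by move=> i; have := xi_box i; rewrite /= in_itv /= => /andP[].
  have ximon : nonincreasing_vec xi by move=> i j ij; exact: (xi_mono (i, j)).
  split=> //; apply/majorizes_prefix_sum => //; split=> [|j]; last exact: xi_maj.
  by apply/eqP; rewrite eq_le xi_tot; exact: xi_maj.
apply: compact_closedI.
  apply: (@rV_compact R d (fun=> `[0, M]%classic)) => i; exact: segment_compact.
apply: closedI.
  by apply: closed_bigI => -[i j] _; apply: closed_le_fun; exact: coord_continuous.
apply: closedI.
  apply: closed_bigI => j _; apply: closed_le_fun; first exact: cst_continuous.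
  exact: continuous_prefix_sum.
by apply: closed_le_fun; [exact: continuous_prefix_sum|exact: cst_continuous].
Qed.

(** If v i = 0 with i < s, then v already reaches its total before i, hence so
    does xi, whose entry i is positive: the totals cannot agree. *)
Lemma majorized_pos xi v s : nonincreasing_vec xi -> nonincreasing_vec v ->
  nonneg_vec xi -> nonneg_vec v -> majorizes xi v ->
  (forall i : 'I_d, (i < s)%N -> 0 < xi 0 i) ->
  forall i : 'I_d, (i < s)%N -> 0 < v 0 i.
Proof.
move=> xim vm xi0 v0 /majorizes_prefix_sum-/(_ xim vm)[eqd xij] pos i i_s.
rewrite lt0r v0 andbT; apply/eqP => vi0.
have vE : prefix_sum v i = prefix_sum v d.
  rewrite [RHS]prefix_sum_full// /prefix_sum [RHS](bigID (fun j : 'I_d => (j < i)%N)) /=.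
  rewrite [X in _ + X]big1 ?addr0// => j; rewrite -leqNgt => ij.
  by apply/eqP; rewrite eq_le v0 andbT -vi0 vm.
have : prefix_sum xi i < prefix_sum xi d.
  rewrite [ltRHS]prefix_sum_full// /prefix_sum [ltRHS](bigID (fun j : 'I_d => (j < i)%N)) /=.
  rewrite ltrDl (bigD1 i) ?ltnn//= ltr_wpDr ?pos// sumr_ge0//.
by rewrite eqd -vE ltNge xij.
Qed.

End Feasible.

Lemma convex_setP (R : realType) (M : lmodType R) (A : set M) :
  @convex_set R M A <->
  forall x y p, 0 <= p <= 1 -> A x -> A y -> A (p *: x + (1 - p) *: y).
Proof.
split=> [cA x y p /andP[p0 p1] Ax Ay|cA x y l].
  by have := cA x y (Itv01 p0 p1); rewrite !inE; apply.
rewrite !inE => Ax Ay; apply: (cA x y l%:num) => //; apply/andP; split=> //.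
Qed.

(** * Convex hull of the epigraph *)

Section EpigraphsTheory.
Variables (R : realType) (d s : nat) (phi : R -> R).
Hypothesis s_le_d : (s <= d)%N.
Implicit Types (X : 'M[R]_d) (p : R^o * 'M[R]_d).

Lemma epi_FE : epi (@F_s R phi d s) =
  [set p : R^o * 'M[R]_d | symmetric_mx p.2 /\
     exists xi : 'rV[R]_d, (f_s phi s xi <= p.1%:E)%E /\ Omega_bar (xi, p.2)].
Proof.
apply/seteqP; split=> -[t X] /= [Xs].
  rewrite /F_s; case: ifPn => [|_]; last by rewrite leye_eq.
  rewrite inE => -[Xpsd _] fX; split=> //; exists (eigvals X); split=> //.
  by split=> //=; [exact: eigvals_nonneg|have [] := eigvalsP Xs].
move=> [xi [fxt [/= _ Xpsd xiE _]]]; split=> //=; rewrite /F_s -xiE.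
rewrite ifT// inE; split=> //; apply/le_rank_eigvals => //.
by rewrite -xiE; have /f_s_leP[] := fxt.
Qed.

(** Lower semicontinuity is what makes the infimum g_s attained. *)
Lemma epi_GE : lower_semicontinuous (phi_ext phi) -> epi (@G_s R phi d s) =
  [set p : R^o * 'M[R]_d | symmetric_mx p.2 /\
     exists xi : 'rV[R]_d, (f_s phi s xi <= p.1%:E)%E /\ Omega_hat (xi, p.2)].
Proof.
move=> lscphi; apply/seteqP; split=> -[t X] /= [Xs]; have [Xm _] := eigvalsP Xs.
  rewrite /G_s; case: ifPn => [|_]; last by rewrite leye_eq.
  rewrite inE => -[Xpsd _] gX; split=> //.
  have [xi [xi0 xiX xim] fxt] :=
    compact_lsc_attained (compact_majorant_set Xm) (@lsc_f_s _ _ d s lscphi) gX.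
  by exists xi.
move=> [xi [fxt [/= xi0 Xpsd xiX xim]]]; split=> //=; rewrite /G_s ifT.
  by apply: ge_ereal_inf; exists (f_s phi s xi) => //; exists xi.
rewrite inE; split=> //; apply/le_rank_eigvals => //.
have /f_s_leP[pos _] := fxt.
by apply: (majorized_pos xim Xm xi0 _ xiX pos); exact: eigvals_nonneg.
Qed.

Lemma epi_F_sub_G : lower_semicontinuous (phi_ext phi) ->
  epi (@F_s R phi d s) `<=` epi (@G_s R phi d s).
Proof.
move=> lscphi; rewrite epi_FE epi_GE// => -[t X] /= [Xs [xi [fxt [/= xi0 Xpsd xiE xim]]]].
split=> //; exists xi; split=> //; split=> //=; rewrite -xiE.
by split.
Qed.

Lemma convex_epi_G : lower_semicontinuous (phi_ext phi) ->
  convex_function (`]0, +oo[%classic : set R^o) phi ->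
  @convex_set R (R^o * 'M[R]_d)%type (epi (@G_s R phi d s)).
Proof.
move=> lscphi cphi; rewrite epi_GE//; apply/convex_setP.
move=> [t X] [t' Y] p p01 /= [Xs [xi [fxi [/= xi0 Xpsd xiX xim]]]].
move=> [Ys [xi' [fxi' [/= xi'0 Ypsd xi'Y xi'm]]]].
have [p0 q0] : 0 <= p /\ 0 <= 1 - p by move/andP: p01 => [? ?]; rewrite subr_ge0.
split; first exact: symmetric_comb.
exists (p *: xi + (1 - p) *: xi'); split; first exact: f_s_convex.
split=> /=.
- by move=> i; rewrite !mxE addr_ge0// mulr_ge0.
- exact: psd_comb.
- exact: majorizes_eigvals_comb.
- exact: nonincreasing_comb.
Qed.

(** The set C of vectors v all of whose permutations give points
    (t, U^T diag(v) U) of A is convex and closed under permutations; it contains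
    xi, hence also the eigenvalues of X. *)
Lemma epi_G_sub_conv (A : set (R^o * 'M[R]_d)) :
  lower_semicontinuous (phi_ext phi) ->
  @convex_set R (R^o * 'M[R]_d)%type A -> epi (@F_s R phi d s) `<=` A ->
  epi (@G_s R phi d s) `<=` A.
Proof.
move=> lscphi /convex_setP cA FA; rewrite epi_GE//.
move=> [t X] /= [Xs [xi [fxt [/= xi0 Xpsd xiX xim]]]].
have [Xm _] := eigvalsP Xs; have [U UU XE] := spectral_eigvals Xs.
pose C := [set v : 'rV[R]_d | forall sg : 'S_d,
  A (t : R^o, U^T *m diag_mx (\row_i v 0 (sg i)) *m U)].
suff /(_ 1%g) : C (eigvals X).
  rewrite [X in diag_mx X](_ : _ = eigvals X) -?XE//.
  by apply/rowP => i; rewrite mxE perm1.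
have /majorizes_prefix_sum-/(_ xim Xm)[eqd xij] := xiX.
apply: (majorization_convex _ _ Xm eqd xij).
- move=> x y p p01 Cx Cy sg; have := cA _ _ p p01 (Cx sg) (Cy sg).
  congr (A _); congr (_, _).
    by rewrite /= -[LHS]scalerDl addrC subrK scale1r.
  have -> : \row_i (p *: x + (1 - p) *: y) 0 (sg i) =
      p *: (\row_i x 0 (sg i)) + (1 - p) *: (\row_i y 0 (sg i)).
    by apply/rowP => i; rewrite !mxE.
  by rewrite linearD /= !linearZ /= mulmxDr mulmxDl -!scalemxAr -!scalemxAl.
- move=> x i j Cx sg; have := Cx (sg * tperm i j)%g.
  congr (A (_, _ *m diag_mx _ *m _)); apply/rowP => k.
  by rewrite !mxE permM.
move=> sg; apply: FA; rewrite epi_FE /=.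
have Zpsd : psd_mx (U^T *m diag_mx (\row_i xi 0 (sg i)) *m U).
  by apply: psd_conj => i; rewrite mxE.
split; first by case: Zpsd.
by exists xi; split=> //; split=> //=; rewrite eigvals_conj.
Qed.

End EpigraphsTheory.

Theorem corollary1 (R : realType) (d s : nat) (phi : R -> R)
    (s_ge1 : (1 <= s)%N) (s_le_d : (s <= d)%N)
    (phi_closed : lower_semicontinuous (phi_ext phi))
    (phi_convex : convex_function (`]0, +oo[%classic : set R^o) phi)
    (phi_nonincreasing : {in `]0, +oo[ &, forall x y, x <= y -> phi y <= phi x}) :
  [/\ conv_hull (epi (@F_s R phi d s)) = epi (@G_s R phi d s),
      epi (@F_s R phi d s) =
        [set p : R^o * 'M[R]_d | symmetric_mx p.2 /\
           exists xi : 'rV[R]_d, (f_s phi s xi <= p.1%:E)%E /\ Omega_bar (xi, p.2)]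
    & epi (@G_s R phi d s) =
        [set p : R^o * 'M[R]_d | symmetric_mx p.2 /\
           exists xi : 'rV[R]_d, (f_s phi s xi <= p.1%:E)%E /\ Omega_hat (xi, p.2)]].
Proof.
split; [|exact: epi_FE|exact: epi_GE].
apply/seteqP; split.
  by apply: smallest_sub; [exact: convex_epi_G|exact: epi_F_sub_G].
by move=> p Gp A [cA FA]; exact: (epi_G_sub_conv _ phi_closed cA FA).
Qed.
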